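(* (1) For all integers $d_1,d_2$ with $1<d_1,d_2\le n$, $\mathsf{NOBDD}_n^{d_2}\not\subseteq\mathsf{NUOBDD}_n^{d_1}$. (2) Let $n$ be a perfect square. For all integers $d_1,d_2$ with $1<d_1,d_2<\sqrt{n}-\frac{5}{4}\log_2 n-1$, $\mathsf{NUOBDD}_n^{d_2}\not\subseteq\mathsf{NOBDD}_n^{d_1}$.
   Context: $\mathsf{NOBDD}_n^{d}$ (resp. $\mathsf{NUOBDD}_n^{d}$) denotes the class of Boolean functions $f:\{0,1\}^n\to\{0,1\}$ computable by an NOBDD (resp. NUOBDD) of width at most $d$. An OBDD on variables $x_1,\dots,x_n$ is a directed acyclic graph with one source whose nodes are partitioned into levels $V_0,\dots,V_\ell$; nodes of $V_\ell$ are accepting or rejecting sinks; all nodes of $V_j$ ($j<\ell$) query the same variable and have edges labelled 0 and 1 only into $V_{j+1}$; each variable is queried at most once on every path. In a nondeterministic OBDD (NOBDD) a node may have several outgoing edges with the same label and an input is accepted iff some consistent path reaches an accepting sink; width is $\max_j|V_j|$. A unitary OBDD (UOBDD) of width $d$ is $(Q,|\psi^0\rangle,T,Q_{acc})$: $Q=\{q_1,\dots,q_d\}$ indexes an orthonormal basis of $\mathbb{C}^d$, $|\psi^0\rangle$ a unit vector, $Q_{acc}\subseteq Q$, $T=((i_j,U_j(0),U_j(1)))_{j=1}^n$ with $(i_1,\dots,i_n)$ a permutation of $\{1,\dots,n\}$ and $U_j(b)$ unitary. On input $\sigma$ the final state is $U_n(\sigma_{i_n})\cdots U_1(\sigma_{i_1})|\psi^0\rangle$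 and the acceptance probability is the squared norm of its projection onto the span of accepting basis states. An NUOBDD computes $f$ if for all $\sigma$: $f(\sigma)=1$ iff the acceptance probability is nonzero. *)

(* Defs.v *)
(* MathComp-Analysis, with the complex numbers R[i] over R : realType from
   mathcomp-real-closed and unitary matrices from algebra/spectral. *)
From HB Require Import structures.
From mathcomp Require Import all_boot all_order all_fingroup all_algebra.
From mathcomp Require Import complex.
From mathcomp Require Import all_classical all_reals all_analysis.

Set Implicit Arguments.
Unset Strict Implicit.
Unset Printing Implicit Defensive.

Import Order.TTheory GRing.Theory Num.Theory.

Local Open Scope ring_scope.

Definition input (n : nat) := {ffun 'I_n -> bool}.
Definition boolfun (n : nat) := input n -> bool.

(* [edge u b v] means that there is an edge labelled b from u to v.  The field
   [query] is [None] exactly on the sinks, i.e. on the last level.  The program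
   is nondeterministic: a nonsink node has one or more outgoing edges for each
   label b (a deterministic OBDD would have exactly one).  Acyclicity is a
   consequence of [edge_level]. *)
Record nobdd (n : nat) := NOBDD {
  node : finType;
  depth : nat;
  level : node -> 'I_depth.+1;
  query : node -> option 'I_n;
  edge : node -> bool -> node -> bool;
  source : node;
  accepting : {set node};
  level_source : level source = ord0;
  unique_source :
    forall v, (forall u b, ~~ edge u b v) <-> v = source;
  query_sink : forall v, (query v == None) = (level v == ord_max);
  query_level : forall u v, level u = level v -> query u = query v;
  edge_level :
    forall u b v, edge u b v -> level v = (level u).+1 :> nat;
  edge_total :
    forall u b, level u != ord_max -> exists v, edge u b v;
  read_once :
    forall u p, path [rel x y | [exists b, edge x b y]] u p ->
      uniq (pmap query (u :: p));
  accepting_sink : forall v, v \in accepting -> level v = ord_max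
}.

Arguments level {n} P v : rename.
Arguments query {n} P v : rename.
Arguments edge {n} P u b v : rename.

Definition nobdd_width n (P : nobdd n) : nat :=
  (\max_(j < (depth P).+1) #|[set v : node P | level P v == j]|)%N.

Definition consistent n (P : nobdd n) (s : input n) : rel (node P) :=
  fun u v => if query P u is Some i then edge P u (s i) v else false.

Definition nobdd_accepts n (P : nobdd n) (s : input n) : Prop :=
  exists2 p, path (consistent s) (source P) p
           & last (source P) p \in accepting P.

Definition NOBDD_class (n d : nat) : set (boolfun n) :=
  [set f : boolfun n | exists P : nobdd n, (nobdd_width P <= d)%N /\
     forall s : input n, f s <-> nobdd_accepts P s].
Arguments NOBDD_class : clear implicits.

Definition sqnorm (R : realType) d (v : 'cV[R[i]]_d) : R[i] :=
  \sum_(q < d) `|v q 0| ^+ 2.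

(* A unitary OBDD of width d: step j reads the variable of index [uorder j] and
   applies [utrans j b] when its value is b. *)
Record uobdd (R : realType) (n d : nat) := UOBDD {
  uinit : 'cV[R[i]]_d;
  uorder : 'S_n;
  utrans : 'I_n -> bool -> 'M[R[i]]_d;
  uaccepting : {set 'I_d};
  uinit_unit : sqnorm uinit = 1;
  utrans_unitary : forall j b, utrans j b \is unitarymx
}.

(* [enum 'I_n] lists 'I_n in increasing order. *)
Definition final_state (R : realType) n d (P : uobdd R n d) (s : input n) :
    'cV[R[i]]_d :=
  foldl (fun v j => utrans P j (s (uorder P j)) *m v) (uinit P) (enum 'I_n).

Definition acc_proj (R : realType) n d (P : uobdd R n d) (v : 'cV[R[i]]_d) :
    'cV[R[i]]_d :=
  \col_q (if q \in uaccepting P then v q 0 else 0).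

Definition acc_prob (R : realType) n d (P : uobdd R n d) (s : input n) : R[i] :=
  sqnorm (acc_proj P (final_state P s)).

Definition NUOBDD_class (R : realType) (n d : nat) : set (boolfun n) :=
  [set f : boolfun n | exists d' (P : uobdd R n d'), (d' <= d)%N /\
     forall s : input n, f s <-> acc_prob P s != 0].
Arguments NUOBDD_class : clear implicits.

Definition log2 (R : realType) (x : R) : R := ln x / ln 2.

(* Main.v *)
(**
Both separations already hold with the smallest width, 2, on the stronger side.

(1) The conjunction of all the variables has an OBDD of width 2.  In a unitary
OBDD computing it, the span of the states from which nothing is accepted any
more strictly grows at every step, because a unitary map is injective and the
all-ones state is outside that span; so the width exceeds n.

(2) View the n = m^2 variables as a 0/1 matrix and ask that it is not a
permutation matrix.  All row and column sums equal 1 iff one weighted sum of the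
bits, with weights read in a large base, equals a target t; rotating a real
qubit by an irrational angle for each unit of weight detects that the sum
differs from t.  Conversely, in an NOBDD send a permutation p to the first level
where k = m/2 of its ones have been read, together with the set of nodes
reachable there: at most n 2^d values.  If p and q have the same image, reading
the first part of p and the second part of q is rejected, hence is again a
permutation matrix, so p and q map the same k rows onto the same k columns.
Thus m! <= n 2^d k! (m-k)!, i.e. C(m, k) <= n 2^d, against the bound on d.
*)
Require Import Defs.
From HB Require Import structures.
From mathcomp Require Import all_boot all_order all_fingroup all_algebra.
From mathcomp Require Import complex.
From mathcomp Require Import zify ring lra.
From mathcomp Require Import all_classical all_reals all_analysis.

Import Order.TTheory GRing.Theory Num.Theory.

Local Open Scope ring_scope.

Set Implicit Arguments.
Unset Strict Implicit.
Unset Printing Implicit Defensive.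

(** * The conjunction needs unitary width n + 1 *)

Lemma dim_add_line (K : fieldType) (V : vectType K) (F : {vspace V}) v :
  v \notin F -> \dim (F + <[v]>) = (\dim F).+1.
Proof.
move=> vF; have v0: v != 0 by apply: contraNneq vF => ->; exact: mem0v.
rewrite dimv_disjoint_sum ?dim_vline ?v0 ?addn1 //.
apply/eqP; rewrite -subv0; apply/subvP => u /memv_capP[uF /vlineP[c uE]].
rewrite memv0 uE; move: uF; rewrite uE; have [->|c0] := eqVneq c 0.
  by rewrite scale0r.
by rewrite rpredZeq (negbTE c0) (negbTE vF).
Qed.

Section UnitaryRuns.
Variables (R : realType) (n d : nat) (P : uobdd R n d).
Implicit Types (v : 'cV[R[i]]_d) (b : 'I_n -> bool) (l : seq 'I_n).

(** Bits are indexed by reading step instead of by variable, which keeps [uorder] out of the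
    induction on the remaining steps. *)
Definition run b l v := foldl (fun v j => utrans P j (b j) *m v) v l.

Lemma run_linear b l : linear (run b l).
Proof.
by elim: l => [|j l IH] c u v //=; rewrite mulmxDr -scalemxAr IH.
Qed.

Lemma run_0 b l : run b l 0 = 0.
Proof. by elim: l => //= j l; rewrite mulmx0. Qed.

Lemma eq_in_run b b' l v : {in l, b =1 b'} -> run b l v = run b' l v.
Proof.
elim: l v => [|j l IH] v //= eqb; rewrite eqb ?mem_head // IH // => i il.
by rewrite eqb // inE il orbT.
Qed.

Lemma acc_proj_linear : linear (acc_proj P).
Proof.
move=> c u v; apply/colP => q; rewrite !mxE.
by case: ifP => // _; rewrite mulr0 addr0.
Qed.

Lemma acc_proj0 : acc_proj P 0 = 0.
Proof. by apply/colP => q; rewrite !mxE if_same. Qed.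

Lemma sqnorm_eq0 v : (sqnorm v == 0) = (v == 0).
Proof.
rewrite psumr_eq0 => [|q _]; last exact: exprn_ge0.
apply/allP/eqP => [v0|-> q _]; last by rewrite mxE normr0 expr0n eqxx.
apply/colP => q; rewrite mxE; apply/eqP.
by have := v0 q (mem_index_enum q); rewrite /= sqrf_eq0 normr_eq0.
Qed.

(* [F] consists of states from which every continuation is rejected, and
   [psi] is accepted exactly when all remaining bits are 1.  Hence [psi] is
   not in [F], and reading a 0 sends [F + <[psi]>] injectively into the next
   space of hopeless states: its dimension grows at every step. *)
Lemma dim_hopeless l (F : {vspace 'cV[R[i]]_d}) psi : uniq l ->
  (forall b u, u \in F -> acc_proj P (run b l u) = 0) ->
  (forall b, ~~ all b l -> acc_proj P (run b l psi) = 0) ->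
  acc_proj P (run (fun=> true) l psi) != 0 ->
  (\dim F + size l < d)%N.
Proof.
elim: l F psi => [|j l IH] F psi /= ul Frej psirej psiacc.
all: have psiNF: psi \notin F by apply: contraNN psiacc => /(Frej (fun=> true))/= ->.
  have := dimvS (subvf (F + <[psi]>)%VS).
  by rewrite dim_add_line // dimvf (muln1 d : dim 'cV[R[i]]_d = d) addn0.
case/andP: ul => jl ul.
pose U0 : {linear 'cV[R[i]]_d -> 'cV[R[i]]_d} := mulmx (utrans P j false).
have U0inj: lker (linfun U0) == 0%VS.
  apply/lker0P => u v; rewrite !lfunE /=.
  have U_unit: utrans P j false \in unitmx by rewrite unitarymx_unit ?utrans_unitary.
  by move/(congr1 (mulmx (invmx (utrans P j false)))); rewrite !mulKmx.
(* As [j] is not in [l], the bit at [j] can be overridden without affecting the continuation. *)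
have run0 b u : run b l (utrans P j false *m u) =
    run (fun i => if i == j then false else b i) (j :: l) u.
  rewrite /= eqxx; apply: eq_in_run => i il; case: eqP => // ij.
  by rewrite -ij il in jl.
have := IH (linfun U0 @: (F + <[psi]>))%VS (utrans P j true *m psi) ul.
rewrite limg_dim_eq ?(eqP U0inj) ?capv0 // dim_add_line // addSnnS; apply => //.
- move=> b _ /memv_imgP[_ /memv_addP[u uF [_ /vlineP[c ->] ->]] ->].
  rewrite lfunE /= run0 addrC run_linear acc_proj_linear.
  rewrite [acc_proj P (run _ (j :: l) u)]Frej //.
  rewrite [acc_proj _ _]psirej ?scaler0 ?addr0 //.
  by rewrite /= eqxx.
- move=> b bl; rewrite -(psirej (fun i => if i == j then true else b i)).
    rewrite /= eqxx; congr acc_proj; apply: eq_in_run => i il.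
    by case: eqP => // ij; rewrite -ij il in jl.
  rewrite /= eqxx /=; apply: contraNN bl => /allP bl; apply/allP => i il.
  by have := bl i il; case: eqP => // ij; rewrite -ij il in jl.
Qed.

End UnitaryRuns.

Lemma and_notin_NUOBDD (R : realType) n d (f : boolfun n) :
  (forall s, f s = [forall i, s i]) -> (d <= n)%N -> ~ NUOBDD_class R n d f.
Proof.
move=> fE dn [d' [P [d'd fP]]].
have rejE b :
    (acc_proj P (run P b (enum 'I_n) (uinit P)) == 0) = ~~ all b (enum 'I_n).
  (* Undoing the reading order makes step [j] see the bit [b j]. *)
  pose s : input n := [ffun i => b ((uorder P)^-1%g i)].
  have -> : run P b (enum 'I_n) (uinit P) = final_state P s.
    by apply: eq_in_run => j _; rewrite ffunE permK.
  rewrite -sqnorm_eq0 -[LHS]negbK; congr (~~ _).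
  transitivity (f s); first by apply/idP/idP => /fP.
  rewrite fE; apply/forallP/allP => [bs j _|bs i]; last by rewrite ffunE bs ?mem_enum.
  by have := bs (uorder P j); rewrite ffunE permK.
have: (\dim (0 : {vspace 'cV[R[i]]_d'}) + size (enum 'I_n) < d')%N.
  apply: (@dim_hopeless _ _ _ P _ _ (uinit P)); first exact: enum_uniq.
  - move=> b u; rewrite memv0 => /eqP ->.
    by rewrite run_0 acc_proj0.
  - by move=> b bl; apply/eqP; rewrite rejE.
  - by rewrite rejE negbK all_predT.
by rewrite dimv0 size_enum_ord ltnNge (leq_trans d'd).
Qed.

(** * The conjunction has an OBDD of width 2 *)

Section AndOBDD.
Variable n : nat.

(* [None] is the source; [Some (j, b)] lies on level [j.+1], and [b] records
   whether all the bits read so far are 1. *)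
Definition and_node := option ('I_n * bool).

Definition and_level (v : and_node) : 'I_n.+1 :=
  if v is Some (j, _) then lift ord0 j else ord0.

Definition and_status (v : and_node) := if v is Some (_, b) then b else true.

(** Level [j] reads variable [j]; [insub] fails exactly on the last level, whose index is [n]. *)
Definition and_query (v : and_node) : option 'I_n := insub (and_level v : nat).

Definition and_edge (u : and_node) (b : bool) (v : and_node) :=
  if v is Some (j, c) then (and_level u == j :> nat) && (c == b && and_status u)
  else false.

Lemma and_edge_level u b v : and_edge u b v ->
  and_level v = (and_level u).+1 :> nat.
Proof. by case: v => [[j c]|] // /andP[/eqP-> _]; exact: lift0. Qed.

Lemma and_level_status_inj u v :
  and_level u = and_level v -> and_status u = and_status v -> u = v.
Proof.
case: u v => [[i b]|] [[j c]|] //= /(congr1 val); rewrite /= ?/bump //= !add1n.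
by case=> /val_inj -> ->.
Qed.

Lemma and_unique_source v : (forall u b, ~~ and_edge u b v) <-> v = None.
Proof.
split=> [|-> //]; case: v => [[j c]|] // noin.
(* A parent of level [j] and status true enters [Some (j, c)] by the label [c]; for [j = 0] it is
   the source. *)
have [u /eqP uj us]: exists2 u, and_level u = j :> nat & and_status u.
  case: j {noin} => [[|j] jn]; first by exists None.
  by exists (Some (Ordinal (ltnW jn), true)).
by have := noin u c; rewrite /= uj us andbT eqxx.
Qed.

Lemma and_query_sink v : (and_query v == None) = (and_level v == ord_max).
Proof.
rewrite /and_query; case: insubP => [i vn _|]; last first.
  rewrite -leqNgt => nv; rewrite eqxx; apply/esym/eqP/val_inj/eqP => /=.
  by rewrite eqn_leq nv -ltnS ltn_ord.
by apply/esym/negbTE; rewrite -val_eqE /= ltn_eqF.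
Qed.

Lemma and_edge_total u b : and_level u != ord_max -> exists v, and_edge u b v.
Proof.
rewrite -and_query_sink /and_query; case: insubP => // i _ iE _.
by exists (Some (i, b && and_status u)); rewrite /= iE !eqxx.
Qed.

(** The level increases along each edge and doubles as the index of the queried variable. *)
Lemma and_read_once u p :
  path [rel x y | [exists b, and_edge x b y]] u p ->
  uniq (pmap and_query (u :: p)).
Proof.
move=> up; rewrite (_ : pmap _ _ = pmap insub (map (val \o and_level) (u :: p))).
  rewrite pmap_sub_uniq // (sorted_uniq ltn_trans ltnn) // sorted_map.
  apply: sub_path up => x y /existsP[b /and_edge_level xy] /=.
  by rewrite [X in (_ < X)%N]xy.
by elim: (u :: p) => //= x s ->.
Qed.

Definition and_obdd : nobdd n.
Proof.
refine (@NOBDD n and_node n and_level and_query and_edge None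
  [set v | (and_level v == ord_max) && and_status v] erefl and_unique_source
  and_query_sink _ and_edge_level and_edge_total and_read_once _).
- by move=> u v; rewrite /and_query => ->.
- by move=> v; rewrite inE => /andP[/eqP].
Defined.

(** [and_status] separates the nodes of one level, which therefore embeds into [bool]. *)
Lemma and_obdd_width : (nobdd_width and_obdd <= 2)%N.
Proof.
apply/bigmax_leqP => j _; rewrite -card_bool -(card_in_imset (f := and_status)).
  exact: max_card.
move=> u v; rewrite !inE => /eqP uj /eqP vj; apply: and_level_status_inj.
by rewrite [LHS]uj [RHS]vj.
Qed.

Lemma and_obdd_accepts (s : input n) :
  [forall i, s i] <-> nobdd_accepts and_obdd s.
Proof.
split=> [/forallP s1|[p]].
  (* Induction on the number [k] of levels still to cross, through nodes of status true. *)
  suff H k : forall u, (and_level u + k = n)%N -> and_status u ->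
      exists2 p, path (@consistent n and_obdd s) u p &
        last u p \in accepting and_obdd.
    exact: (H n).
  elim: k => [|k IH] u /=.
    rewrite addn0 => un us; exists [::] => //=; rewrite inE us andbT.
    exact/eqP/val_inj.
  move=> uk us; have un: (and_level u < n)%N.
    by rewrite -[X in (_ < X)%N]uk addnS ltnS leq_addr.
  have [|//|p vp pacc] := IH (Some (Ordinal un, true)).
    by rewrite /= /bump /= add1n addSnnS.
  exists (Some (Ordinal un, true) :: p) => //=; rewrite vp andbT.
  by rewrite /consistent /= /and_query insubT /= eqxx s1 us.
suff H u : path (@consistent n and_obdd s) u p ->
    last u p \in accepting and_obdd ->
    and_status u /\ forall i : 'I_n, (and_level u <= i)%N -> s i.
  by move=> sp pacc; apply/forallP => i; have [_] := H None sp pacc; apply.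
elim: p u => [|v p IH] u /=.
  rewrite inE => _ /andP[/eqP-> us]; split=> // i.
  by rewrite leqNgt ltn_ord.
case/andP=> uv vp pacc; have {IH pacc vp} [vs si] := IH v vp pacc.
move: uv; rewrite /consistent /= /and_query; case: insubP => // i _ iE uv.
have lv := and_edge_level uv; case: v uv vs lv si => [[j c]|] //=.
case/andP=> /eqP uj /eqP -> /andP[sui us] _ si; split=> // i'.
rewrite leq_eqVlt => /orP[/eqP ui'|ui'].
  by rewrite (_ : i' = i) //; apply: val_inj; rewrite iE.
by apply: si; rewrite /= -uj.
Qed.

End AndOBDD.

Lemma and_in_NOBDD n d : (1 < d)%N ->
  NOBDD_class n d (fun s : input n => [forall i, s i]).
Proof.
move=> d1; exists (and_obdd n); split; last exact: and_obdd_accepts.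
exact: leq_trans (and_obdd_width n) d1.
Qed.

(** * Exact cover with a single qubit *)

Section RotationOBDD.
Variable R : realType.
Implicit Types (z w : R[i]).

(** The complex number [w] becomes a real vector, on which multiplication by [z] of modulus 1 acts
    as the rotation matrix [rotC z]. *)
Definition vecC w : 'cV[R[i]]_2 :=
  \col_q (if q == 0 then complex.Re w else complex.Im w)%:C%C.

Definition rotC z : 'M[R[i]]_2 := \matrix_(p, q)
  (if p == 0 then if q == 0 then complex.Re z else - complex.Im z
   else if q == 0 then complex.Im z else complex.Re z)%:C%C.

Lemma rotC_vecC z w : rotC z *m vecC w = vecC (z * w).
Proof.
case: z w => [a b] [c d]; apply/colP => p.
rewrite !mxE big_ord_recl big_ord1 !mxE /=.
by case: (p == 0); rewrite -!rmorphM -rmorphD; congr (_%:C)%C; rewrite ?mulNr // addrC.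
Qed.

Lemma norm1_sqr z : `|z| = 1 -> complex.Re z ^+ 2 + complex.Im z ^+ 2 = 1.
Proof.
case: z => a b z1; have := sqr_normc (a +i* b)%C.
rewrite z1 expr1n => /(congr1 (@complex.Re R)) /= ->; ring.
Qed.

Lemma sqnorm_vecC w : `|w| = 1 -> sqnorm (vecC w) = 1.
Proof.
move=> /norm1_sqr w1; rewrite /sqnorm big_ord_recl big_ord1 !mxE /=.
by rewrite !sqr_normc !conjc_real -!rmorphM -rmorphD -!expr2 w1.
Qed.

Lemma rotC_unitary z : `|z| = 1 -> rotC z \is unitarymx.
Proof.
move=> /norm1_sqr; case: z => a b /= ab1; apply/unitarymxP/matrixP => p q.
rewrite !mxE big_ord_recl big_ord1 !mxE /=.
rewrite -[X in _ = X *+ _]/(1%:C)%C.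
have cjE (x : R) : ((x%:C)%C)^*%R = (x%:C)%C by exact: conjc_real.
rewrite !cjE -!rmorphM -rmorphD -rmorphMn; congr (_%:C)%C.
case: p q => [[|[|p]] //= ?] [[|[|q]] //= ?]; rewrite -?ab1 ?mulr0n; ring.
Qed.

Definition zrot : R[i] := (3%:R / 5%:R +i* (4%:R / 5%:R))%C.

Lemma norm_zrot : `|zrot| = 1.
Proof.
have zz1 : (3%:R / 5%:R) ^+ 2 + (4%:R / 5%:R) ^+ 2 = 1 :> R by field.
by rewrite normc_def /= zz1 sqrtr1.
Qed.

(* [3 + 4i] is idempotent modulo 5, so no power of it is real: [zrot] is an
   irrational rotation. *)
Lemma zrotX k : (0 < k)%N -> exists a b : int,
  zrot ^+ k = ((3 + 5 * a)%:~R / 5 ^+ k +i* ((4 + 5 * b)%:~R / 5 ^+ k))%C.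
Proof.
case: k => // k _; elim: k => [|k [a [b IH]]].
  by exists 0, 0; rewrite expr1.
(* Expand (3 + 5a + (4 + 5b)i)(3 + 4i), using (3 + 4i)^2 = -7 + 24i. *)
exists (-2 + 3 * a - 4 * b), (4 + 4 * a + 3 * b).
rewrite exprS IH /zrot; apply/eqP; rewrite eq_complex /=.
have X0 : (5 : R) ^+ k.+1 != 0 by rewrite expf_neq0.
rewrite (exprS _ k.+1); apply/andP; split; apply/eqP; field; rewrite ?X0 //.
Qed.

Lemma Im_zrotX k : (0 < k)%N -> complex.Im (zrot ^+ k) != 0.
Proof.
move=> /zrotX[a [b ->]] /=; rewrite mulf_neq0 ?invr_eq0 ?expf_neq0 //.
rewrite intr_eq0; lia.
Qed.

(** Since [zrot] has modulus 1, the product is the power of exponent |k - t|, conjugated if k < t;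
    no positive power is real. *)
Lemma Im_conjc_zrotX k t :
  (complex.Im (zrot ^+ k * (zrot ^+ t)^*%C) == 0) = (k == t).
Proof.
have zz : zrot * zrot^*%C = 1 by rewrite -sqr_normc norm_zrot expr1n.
have XcE j : (zrot ^+ j)^*%C = zrot^*%C ^+ j by rewrite rmorphXn.
rewrite XcE; have [kt|tk|->] := ltngtP k t.
- rewrite -[in LHS](subnKC (ltnW kt)) exprD mulrA -exprMn zz expr1n mul1r.
  have: complex.Im (zrot ^+ (t - k)) != 0 by rewrite Im_zrotX ?subn_gt0.
  by rewrite -XcE; case: (zrot ^+ _) => a b /=; rewrite oppr_eq0 => /negbTE.
- rewrite -[in LHS](subnK (ltnW tk)) exprD -mulrA -exprMn zz expr1n mulr1.
  by apply/negbTE; rewrite Im_zrotX ?subn_gt0.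
- by rewrite -exprMn zz expr1n /= eqxx.
Qed.

End RotationOBDD.

(** With theta the argument of [zrot], the qubit starts at angle -t theta and ends at (sum - t)
    theta. The accepting amplitude is the sine of that angle, which vanishes only when the sum is
    [t]. *)
Lemma weighted_sum_in_NUOBDD (R : realType) n d (a : 'I_n -> nat) t : (1 < d)%N ->
  NUOBDD_class R n d (fun s : input n => \sum_x a x * s x != t)%N.
Proof.
move=> d1; pose w := (zrot R ^+ t)^*%C.
have norm1X k : `|zrot R ^+ k| = 1 by rewrite normrX norm_zrot expr1n.
have w1 : `|w| = 1 by rewrite normcJ norm1X.
pose P := @UOBDD R n 2 (vecC w) 1%g (fun j b => rotC (zrot R ^+ (a j * b)))
  [set ord_max] (sqnorm_vecC w1) (fun j b => rotC_unitary (norm1X _)).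
exists 2, P; split=> // s.
have finalE : final_state P s = vecC (zrot R ^+ (\sum_x a x * s x)%N * w).
  have H l k : foldl (fun v j => utrans P j (s (uorder P j)) *m v)
      (vecC (zrot R ^+ k * w)) l = vecC (zrot R ^+ (k + \sum_(x <- l) a x * s x)%N * w).
    elim: l k => [|j l IH] k /=; first by rewrite big_nil addn0.
    by rewrite perm1 rotC_vecC mulrA -exprD IH big_cons addnAC addnC addnA.
  by rewrite -big_enum -[X in _ = vecC (_ ^+ X * _)]add0n -H expr0 mul1r.
rewrite /acc_prob finalE /sqnorm big_ord_recl big_ord1 !mxE /=.
rewrite !inE /= normr0 expr0n add0r sqrf_eq0 normr_eq0.
by rewrite eq_complex /= eqxx andbT Im_conjc_zrotX.
Qed.

Section ExactCover.
Variables (L : finType) (n : nat) (line : L -> {set 'I_n}).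

Definition exact_cover (s : input n) := [forall l, #|[set x in line l | s x]| == 1]%N.

(** Uniqueness of base-[B] digits, the head of [r] being the least significant: reduce modulo [B]
    for the head, then divide by [B]. *)
Lemma sum_digits_inj B (r : seq L) (c e : L -> nat) : uniq r ->
  (forall l, c l < B)%N -> (forall l, e l < B)%N ->
  (\sum_(l <- r) c l * B ^ index l r = \sum_(l <- r) e l * B ^ index l r)%N ->
  {in r, c =1 e}.
Proof.
move=> ur cB eB; elim: r ur => // l r IH /= /andP[lr ur].
rewrite !big_cons eqxx !muln1.
have shift (f : L -> nat) :
    (\sum_(k <- r) f k * B ^ (if l == k then 0 else (index k r).+1) =
    (\sum_(k <- r) f k * B ^ index k r) * B)%N.
  rewrite big_distrl /= big_seq [RHS]big_seq; apply: eq_bigr => k kr.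
  by case: eqP => [lk|_]; [rewrite lk kr in lr | rewrite expnSr mulnA].
rewrite !shift => eqce; have ce : c l = e l.
  have := congr1 (modn^~ B) eqce.
  by rewrite !(addnC _ (_ * B)%N) /= !modnMDl !modn_small.
move=> k; rewrite inE => /predU1P[-> //|]; apply: IH ur _ k.
move: eqce; rewrite ce => /addnI/eqP; rewrite eqn_mul2r => /orP[/eqP B0|/eqP //].
by have := cB l; rewrite B0.
Qed.

Lemma not_exact_cover_in_NUOBDD (R : realType) d : (1 < d)%N ->
  NUOBDD_class R n d (fun s => ~~ exact_cover s).
Proof.
pose idx l := index l (enum L).
(* The base must exceed every count, at most [n], and also the target digit 1, even for [n = 0]. *)
pose a x := (\sum_(l | x \in line l) n.+2 ^ idx l)%N.
pose t := (\sum_(l <- enum L) 1 * n.+2 ^ idx l)%N.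
move=> d1; suff -> : (fun s => ~~ exact_cover s) =
    (fun s => \sum_x a x * s x != t)%N.
  exact: weighted_sum_in_NUOBDD.
apply/funext => s; congr (~~ _).
(* Double counting: the digits of the weighted sum are the numbers of ones on the lines. *)
have -> : (\sum_x a x * s x =
    \sum_(l <- enum L) #|[set x in line l | s x]| * n.+2 ^ idx l)%N.
  under eq_bigr do rewrite big_distrl /=.
  rewrite (exchange_big_dep predT) //= big_enum /=; apply: eq_bigr => l _.
  rewrite -sum1_card big_distrl /= (bigID (fun x => s x)) /= addnC big1 ?add0n; last first.
    by move=> x /andP[_ /negbTE->]; rewrite muln0.
  by apply: eq_big => [x|x /andP[_ ->]]; rewrite ?inE // muln1 mul1n.
apply/forallP/eqP => [cov|].
  by apply: eq_bigr => l _; rewrite (eqP (cov l)).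
move/sum_digits_inj => H l; apply/eqP; apply: H; rewrite ?enum_uniq ?mem_enum //.
by move=> k; rewrite ltnS (leq_trans (max_card _)) ?card_ord.
Qed.

End ExactCover.

(** * Binomial coefficients *)

Lemma central_bin_rec j :
  ('C(j.+1.*2, j.+1) * j.+1 = 'C(j.*2, j) * (j.*2.+1).*2)%N.
Proof.
have := mul_bin_diag j.+1.*2 j; have := mul_bin_down j.*2.+1 j.
rewrite doubleS /= subSn -?addnn ?leq_addr // addKn; nia.
Qed.

(* Stirling-free form of C(2k, k) >= 4^k / (2 sqrt k). *)
Lemma central_bin_sqr k : (0 < k)%N -> (16 ^ k <= 4 * k * 'C(k.*2, k) ^ 2)%N.
Proof.
case: k => // k _; elim: k => [|k IH] //.
have : (16 ^ k.+2 * k.+2 ^ 2 <= 4 * k.+2 * 'C(k.+2.*2, k.+2) ^ 2 * k.+2 ^ 2)%N.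
  rewrite -mulnA -expnMn central_bin_rec expnMn expnS -!muln2.
  have : (16 ^ k.+1 * (16 * k.+2 * k.+2) <=
      4 * k.+1 * 'C(k.+1.*2, k.+1) ^ 2 * (16 * k.+2 * k.+2))%N.
    by rewrite leq_mul2r IH orbT.
  rewrite -muln2; set X := (16 ^ _)%N; set C := ('C(_, _) ^ 2)%N.
  (* With j = k + 1, this is 4j(j + 1) <= (2j + 1)^2 up to common factors. *)
  have : (C * (16 * k.+2 * k.+2) * (4 * k.+1) <=
      C * (4 * k.+2 * ((k.+1 * 2).+1 * 2) ^ 2))%N.
    rewrite -mulnA leq_mul2l; apply/orP; right; nia.
  nia.
by rewrite leq_pmul2r.
Qed.

(** The even case is [central_bin_sqr] with a factor 2 to spare. For m = 2j + 1, use (j + 1) C(2j +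
    1, j) = (2j + 1) C(2j, j) and 4j(j + 1)^2 <= (2j + 1)^3. *)
Lemma middle_bin_sqr m : (0 < m)%N -> (4 ^ m <= 4 * m * 'C(m, m./2) ^ 2)%N.
Proof.
rewrite -(odd_double_half m); set k := m./2; case: (odd m) => /=; last first.
  rewrite !add0n doubleK double_gt0 => /central_bin_sqr kP.
  rewrite -[X in (4 ^ X)%N]muln2 mulnC expnM; apply: leq_trans kP _.
  by rewrite leq_mul2r -muln2; apply/orP; right; nia.
rewrite add1n /= uphalf_double => _; case: k => // k.
have kP := @central_bin_sqr k.+1 isT.
have := mul_bin_down k.+1.*2.+1 k.+1.
rewrite /= subSn -?addnn ?leq_addr // addKn addnn; move: kP.
set c := 'C(_, _); set c' := 'C(_, _) => kP cE.
have : (4 ^ k.+1.*2.+1 * k.+2 ^ 2 <= 4 * k.+1.*2.+1 * c' ^ 2 * k.+2 ^ 2)%N.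
  rewrite -(mulnA _ (c' ^ 2)%N) -expnMn (mulnC c') -cE expnMn.
  rewrite expnS -muln2 (mulnC _ 2%N) expnM; move: kP.
  rewrite (_ : (4 ^ 2 = 16)%N) //; set X := (16 ^ _)%N; set C := (c ^ 2)%N => kP.
  have : (X * (4 * k.+2 ^ 2) <= 4 * k.+1 * C * (4 * k.+2 ^ 2))%N.
    by rewrite leq_mul2r kP orbT.
  have : (C * (4 * k.+1 * (4 * k.+2 ^ 2)) <=
          C * (4 * (2 * k.+1).+1 * (2 * k.+1).+1 ^ 2))%N.
    rewrite leq_mul2l; apply/orP; right; nia.
  nia.
by rewrite leq_pmul2r.
Qed.

(** Relative to one such permutation [q], each [p * q^-1] stabilizes [A], hence is determined by its
    restrictions to [A] and to the complement. *)
Lemma card_im_perm (T : finType) (A B : {set T}) :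
  (#|[set p : {perm T} | p @: A == B]| <= (#|A|)`! * (#|T| - #|A|)`!)%N.
Proof.
set S := finset _;  have [-> |[q]] := set_0Vmem S; first by rewrite cards0.
rewrite inE => /eqP qA.
have -> : (#|T| - #|A| = #|~: A|)%N by rewrite [RHS]cardsCs finset.setCK.
rewrite -!card_perm.
have <- : #|finset.setX [set p | perm_on A p] [set p | perm_on (~: A) p]| =
    (#|perm_on A| * #|perm_on (~: A)|)%N by rewrite cardsX !cardsE.
pose g p := (restr_perm A (p * q^-1)%g, restr_perm (~: A) (p * q^-1)%g).
have stab p : p \in S -> (p * q^-1 \in 'N(A | 'P))%g.
  rewrite inE => /eqP pA; apply/astabsP => x; rewrite /= apermE permM.
  rewrite -(mem_imset A _ (@perm_inj _ q)) permKV qA -pA mem_imset //.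
  exact: perm_inj.
rewrite -(card_in_imset (f := g)); last first.
  move=> p p' /stab pq /stab p'q [eqA eqA']; apply: (mulIg q^-1%g).
  apply/permP => x; have [xA|xA] := boolP (x \in A).
    by rewrite -(restr_permE pq xA) -(restr_permE p'q xA) eqA.
  rewrite -astabsC in pq; rewrite -astabsC in p'q.
  have {}xA : x \in ~: A by rewrite inE.
  by rewrite -(restr_permE pq xA) -(restr_permE p'q xA) eqA'.
apply/subset_leq_card/fintype.subsetP => _ /imsetP[p _ ->].
by rewrite inE /= !inE !restr_perm_on.
Qed.

(** * Reachable sets of an NOBDD *)

Definition mix n (X : {set 'I_n}) (s t : input n) : input n :=
  [ffun x => if x \in X then s x else t x].

Section Reach.
Variables (n : nat) (P : nobdd n).
Implicit Types (s t : input n) (u v : node P) (i j k : nat).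

Definition reach s j : {set node P} :=
  iter j (fun V : {set node P} => [set v | [exists u in V, consistent s u v]])
    [set source P].

Lemma reachS s j :
  reach s j.+1 = [set v | [exists u in reach s j, consistent s u v]].
Proof. by []. Qed.

Lemma consistent_level s u v : consistent s u v -> level P v = (level P u).+1 :> nat.
Proof. by rewrite /consistent; case: (query P u) => // x; apply: edge_level. Qed.

Lemma reach_level s j v : v \in reach s j -> level P v = j :> nat.
Proof.
elim: j v => [|j IH] v; first by rewrite inE => /eqP->; rewrite level_source.
by rewrite reachS inE => /existsP[u /andP[/IH <- /consistent_level]].
Qed.

Lemma reachP s j v :
  reflect (exists p, [/\ path (consistent s) (source P) p, size p = j &
                         last (source P) p = v])
          (v \in reach s j).
Proof.
elim: j v => [|j IH] v.
  rewrite inE; apply: (iffP eqP) => [->|[p [_ /size0nil-> <-]] //].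
  by exists [::].
rewrite reachS inE; apply: (iffP existsP) => [[u /andP[/IH[p [sp pj <-]] uv]]|].
  by exists (rcons p v); rewrite rcons_path sp uv size_rcons pj last_rcons.
case=> p [sp pj <-]; case/lastP: p sp pj => // p w.
rewrite rcons_path size_rcons last_rcons => /andP[sp pw] [pj].
by exists (last (source P) p); rewrite pw andbT; apply/IH; exists p.
Qed.

Lemma accepts_reach s : nobdd_accepts P s <->
  exists2 v, v \in reach s (depth P) & v \in accepting P.
Proof.
split=> [[p sp pacc]|[v /reachP[p [sp _ <-]] vacc]]; last by exists p.
exists (last (source P) p) => //; apply/reachP; exists p; split=> //.
have /reach_level : last (source P) p \in reach s (size p) by apply/reachP; exists p.
by rewrite (accepting_sink pacc).
Qed.

(** An arbitrary path from the source to a sink. As queries depend only on the level, it exhibits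
    the variable read at each level, and [read_once] along it makes these variables distinct. *)
Definition spine j : node P :=
  iter j (fun u => odflt u [pick v | edge P u true v]) (source P).

Lemma spine_edge j : level P (spine j) != ord_max ->
  edge P (spine j) true (spine j.+1).
Proof.
move=> /(edge_total true)[v jv] /=.
by case: pickP => [//|/(_ v)]; rewrite jv.
Qed.

Lemma spine_level j : (j <= depth P)%N -> level P (spine j) = j :> nat.
Proof.
elim: j => [|j IH] jd; first by rewrite /= level_source.
have lj := IH (ltnW jd); rewrite (edge_level (spine_edge _)) ?lj //.
by rewrite -val_eqE /= lj ltn_eqF.
Qed.

Definition level_query j : option 'I_n := query P (spine j).

Lemma query_of_level u : query P u = level_query (level P u).
Proof.
apply: query_level; apply: val_inj; rewrite /= spine_level //.
by rewrite -ltnS ltn_ord.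
Qed.

Lemma level_query_some j : (j < depth P)%N -> level_query j.
Proof.
move=> jd; have: query P (spine j) != None.
  by rewrite query_sink -val_eqE /= spine_level ?ltn_eqF // ltnW.
by rewrite /level_query; case: query.
Qed.

Lemma level_queryE :
  map some (pmap (query P) (mkseq spine (depth P))) = mkseq level_query (depth P).
Proof.
have all_q : all [eta query P] (mkseq spine (depth P)).
  by apply/allP => _ /mapP[j jd ->]; apply: level_query_some; rewrite mem_iota in jd.
by rewrite pmapS_filter (all_filterP all_q) -map_comp.
Qed.

Lemma spine_read_once : uniq (pmap (query P) (mkseq spine (depth P))).
Proof.
pose p := mkseq (fun j => spine j.+1) (depth P).
have pE : source P :: p = rcons (mkseq spine (depth P)) (spine (depth P)).
  rewrite -[RHS]/(rcons (map _ _) _) -map_rcons -cats1 -[depth P as X in [:: X]]add0n.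
  by rewrite -(iotaD 0 _ 1) addn1 /= (iotaDl 1 0) -map_comp.
have := @read_once _ P (source P) p; rewrite pE -cats1 pmap_cat cat_uniq.
case/(_ _)/andP => //; apply/(pathP (source P)) => j; rewrite size_mkseq => jd.
have -> : nth (source P) (source P :: p) j = spine j.
  by case: j jd => //= j jd; rewrite nth_mkseq // ltnW.
rewrite nth_mkseq //; apply/existsP; exists true; apply: spine_edge.
by rewrite -val_eqE /= spine_level ?ltn_eqF // ltnW.
Qed.

Lemma level_query_inj i j : (i < depth P)%N -> (j < depth P)%N ->
  level_query i = level_query j -> i = j.
Proof.
have := spine_read_once; rewrite -(map_inj_uniq (@Some_inj _)) level_queryE.
by move/mkseq_uniqP => inj id jd; apply: inj.
Qed.

Lemma depth_le : (depth P <= n)%N.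
Proof.
have := max_card (mem (pmap (query P) (mkseq spine (depth P)))).
rewrite card_ord (card_uniqP spine_read_once).
by rewrite -(size_map some) level_queryE size_mkseq.
Qed.

Definition read_before j : {set 'I_n} :=
  [set x | [exists i : 'I_j, level_query i == Some x]].

Lemma read_beforeP j x :
  reflect (exists2 i, (i < j)%N & level_query i = Some x) (x \in read_before j).
Proof.
rewrite inE; apply: (iffP existsP) => [[i /eqP ix]|[i ij ix]].
  by exists i.
by exists (Ordinal ij); apply/eqP.
Qed.

Lemma read_before0 : read_before 0 = finset.set0.
Proof. by apply/setP => x; rewrite finset.in_set0; apply/read_beforeP => -[]. Qed.

Lemma read_beforeS_sub j : (j < depth P)%N ->
  exists x : 'I_n, forall y : 'I_n, y \in read_before j.+1 ->
    (y == x) || (y \in read_before j).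
Proof.
move=> /level_query_some; case jx: level_query => [x|] // _; exists x.
move=> y /read_beforeP[k]; rewrite ltnS leq_eqVlt.
case/predU1P=> [->|kj ky]; first by rewrite jx => -[->]; rewrite eqxx.
by apply/orP; right; apply/read_beforeP; exists k.
Qed.

Lemma eq_step s t (V : {set node P}) : 
  (forall u x, u \in V -> query P u = Some x -> s x = t x) ->
  [set v | [exists u in V, consistent s u v]] =
  [set v | [exists u in V, consistent t u v]].
Proof.
move=> st; apply/setP => v; rewrite !inE; apply: eq_existsb => u.
case uV: (u \in V) => //=; rewrite /consistent.
by case uq: query => [x|] //; rewrite (st u).
Qed.

Lemma eq_reach s t j : {in read_before j, s =1 t} -> reach s j = reach t j.
Proof.
elim: j => [//|j IH] st; rewrite !reachS IH; last first.
  move=> x /read_beforeP[i ij ix]; apply: st.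
  by apply/read_beforeP; exists i; first exact: leqW.
apply: eq_step => u x /reach_level uj; rewrite query_of_level uj => jx.
by apply: st; apply/read_beforeP; exists j.
Qed.

(** By read-once, the levels from [j] on query only variables outside [read_before j], where [s] and
    [t] agree. *)
Lemma eq_reach_after s t j : reach s j = reach t j ->
  (forall x, x \notin read_before j -> s x = t x) ->
  forall k, (j + k <= depth P)%N -> reach s (j + k) = reach t (j + k).
Proof.
move=> eqj st; elim=> [|k IH]; rewrite ?addn0 // addnS => jkd.
rewrite !reachS IH 1?ltnW //; apply: eq_step => u x /reach_level ujk.
rewrite query_of_level ujk => jkx; apply: st; apply/read_beforeP => -[i ij].
rewrite -jkx => /level_query_inj ijk.
have id : (i < depth P)%N.
  by rewrite (leq_trans ij) // (leq_trans _ (ltnW jkd)) // leq_addr.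
by move: ij; rewrite ijk // ltnNge leq_addr.
Qed.

Lemma card_level j : (#|[set v | level P v == j :> nat]| <= nobdd_width P)%N.
Proof.
have [jd|dj] := ltnP j (depth P).+1.
  rewrite (_ : [set _ | _] = [set v | level P v == Ordinal jd]).
    exact: (@leq_bigmax_cond _ predT _ (Ordinal jd)).
  by apply/setP => v; rewrite !inE.
rewrite (_ : [set _ | _] = finset.set0) ?cards0 //; apply/setP => v; rewrite !inE.
by rewrite ltn_eqF // (leq_trans (ltn_ord _)).
Qed.

Variable f : boolfun n.
Hypothesis f_accepts : forall s, f s <-> nobdd_accepts P s.

Lemma eq_computed s t : reach s (depth P) = reach t (depth P) -> f s = f t.
Proof.
move=> st; apply/idP/idP => /f_accepts/accepts_reach[v]; rewrite ?st => vr vacc.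
all: by apply/f_accepts/accepts_reach; exists v; rewrite ?st.
Qed.

Lemma reach_mix j s t : reach (mix (read_before j) s t) j = reach s j.
Proof. by apply: eq_reach => x xj; rewrite ffunE xj. Qed.

(** Cut and paste: at level [j] the mixed input reaches the same set as [s], hence as [t], and from
    there on it reads the bits of [t]. *)
Lemma computed_mix j s t : (j <= depth P)%N -> reach s j = reach t j ->
  f (mix (read_before j) s t) = f t.
Proof.
move=> jd st; apply: eq_computed; rewrite -(subnKC jd).
apply: eq_reach_after; rewrite ?reach_mix ?subnKC // => x xj.
by rewrite ffunE (negbTE xj).
Qed.

Lemma computed_read s t :
  {in read_before (depth P), s =1 t} -> f s = f t.
Proof. by move=> st; apply/eq_computed/eq_reach. Qed.

(* Discrete continuity: the number of 1s read grows by at most one per level. *)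
Lemma exists_level_ones s k :
  (0 < k <= #|[set x in read_before (depth P) | s x]|)%N ->
  exists j, [/\ (j < n)%N, (j.+1 <= depth P)%N &
                #|[set x in read_before j.+1 | s x]| = k].
Proof.
case/andP=> k0 kd; have exj : exists j, (k <= #|[set x in read_before j | s x]|)%N.
  by exists (depth P).
have [j kj jmin] := ex_minnP exj; have jd := jmin _ kd.
case: j kj jmin jd => [|j] kj jmin jd.
  move: kj; rewrite read_before0 (_ : [set _ in _ | _] = finset.set0).
    by rewrite cards0 leqNgt k0.
  by apply/setP => x; rewrite !inE.
(* Read-once bounds the depth by [n], so that at most [n] cut levels are possible. *)
exists j; split=> //; first exact: leq_trans jd depth_le.
apply/eqP; rewrite eqn_leq kj andbT.
have [x xj] := read_beforeS_sub jd.
have jk : (#|[set x in read_before j | s x]| < k)%N.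
  by rewrite ltnNge; apply/negP => /jmin; rewrite ltnn.
apply: leq_trans jk; apply: (@leq_trans #|x |: [set y in read_before j | s y]|).
  apply/subset_leq_card/fintype.subsetP => y.
  by rewrite inE => /andP[/xj yj sy]; rewrite finset.in_setU1 inE sy andbT.
by rewrite cardsU1 -add1n leq_add2r leq_b1.
Qed.

End Reach.

(** * Permutation matrices *)

Section Permutations.
Variables (m n : nat) (cell : 'I_m * 'I_m -> 'I_n) (coord : 'I_n -> 'I_m * 'I_m).
Hypotheses (cellK : cancel cell coord) (coordK : cancel coord cell).
Implicit Types (p q : 'S_m) (X : {set 'I_n}).

Definition board_line (l : 'I_m + 'I_m) : {set 'I_n} :=
  match l with
  | inl r => [set x | (coord x).1 == r]
  | inr c => [set x | (coord x).2 == c]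
  end.

Definition perm_input p : input n := [ffun x => p (coord x).1 == (coord x).2].

Lemma perm_input_row p r :
  [set x in board_line (inl r) | perm_input p x] = [set cell (r, p r)].
Proof.
apply/setP => x; rewrite !inE ffunE -(can_eq coordK) cellK -pair_eqE /=.
by case: eqP => //= ->; rewrite eq_sym.
Qed.

Lemma perm_input_col p c :
  [set x in board_line (inr c) | perm_input p x] = [set cell (p^-1%g c, c)].
Proof.
apply/setP => x; rewrite !inE ffunE -(can_eq coordK) cellK -pair_eqE /= andbC.
by case: ((coord x).2 =P c) => [->|]; rewrite ?andbF // !andbT (canF_eq (permK p)).
Qed.

Lemma perm_input_cover p : exact_cover board_line (perm_input p).
Proof.
by apply/forallP => -[r|c]; rewrite ?perm_input_row ?perm_input_col cards1.
Qed.

Lemma cardI1 X x : #|[set x] :&: X| = (x \in X).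
Proof.
have [xX|xX] := boolP (x \in X).
  by rewrite (finset.setIidPl _) ?cards1 ?finset.sub1set.
by apply: eq_card0 => y; rewrite !inE; case: eqP => // ->; rewrite (negbTE xX).
Qed.

(** On each line both the mixture and [q] have a single one, and they agree outside [X]; so they
    have equally many ones inside [X], where the mixture is [p]. *)
Lemma perm_input_mix X p q :
  exact_cover board_line (mix X (perm_input p) (perm_input q)) ->
  (forall r, (cell (r, p r) \in X) = (cell (r, q r) \in X)) /\
  (forall c, (cell (p^-1%g c, c) \in X) = (cell (q^-1%g c, c) \in X)).
Proof.
move=> /forallP mixP.
have H l : #|[set x in board_line l | perm_input p x] :&: X| =
           #|[set x in board_line l | perm_input q x] :&: X|.
  have /forallP/(_ l)/eqP := perm_input_cover q.
  rewrite -(cardsID X) -{1}(eqP (mixP l)) -[X in _ = X](cardsID X).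
  set A := [set x in board_line l | mix _ _ _ x].
  have -> : A :&: X = [set x in board_line l | perm_input p x] :&: X.
    by apply/setP => x; rewrite !inE ffunE; case: (x \in X); rewrite ?andbF.
  have -> : A :\: X = [set x in board_line l | perm_input q x] :\: X.
    by apply/setP => x; rewrite !inE ffunE; case: (x \in X).
  by move/addIn.
split=> [r|c].
  by have := H (inl r); rewrite !perm_input_row !cardI1; do 2!case: (_ \in X).
by have := H (inr c); rewrite !perm_input_col !cardI1; do 2!case: (_ \in X).
Qed.

(** If the one of [p] in row [r] lay outside [X], the truncated matrix would have an empty row. *)
Lemma perm_input_truncated X p r :
  exact_cover board_line (mix X (perm_input p) [ffun=> false]) ->
  cell (r, p r) \in X.
Proof.
move=> /forallP/(_ (inl r))/eqP sr; apply: contra_eqT sr => pX.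
rewrite (_ : [set _ in _ | _] = finset.set0) ?cards0 //.
apply/setP => x; rewrite !inE !ffunE; case: ifP => xX; rewrite ?andbF //.
apply: contraNF pX => /andP[/eqP<- /eqP->].
by rewrite -surjective_pairing coordK.
Qed.

Lemma perm_input_ones X p :
  #|[set x in X | perm_input p x]| = #|[set r | cell (r, p r) \in X]|.
Proof.
have inj : injective (fun r => cell (r, p r)) by move=> r r' /(can_inj cellK)[].
rewrite -(card_imset _ inj); apply: eq_card => x; rewrite !inE ffunE.
apply/andP/imsetP => [[xX /eqP px]|[r]]; last first.
  by rewrite inE => rX ->; rewrite cellK eqxx.
exists (coord x).1; first by rewrite inE px -surjective_pairing coordK.
by rewrite px -surjective_pairing coordK.
Qed.

(** Let [A] be the rows where [p] has its one in [X]. Agreement on rows gives [q] the same [A], and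
    agreement on columns gives [q @: A = p @: A]. *)
Lemma card_perm_same_cut X p k :
  #|[set x in X | perm_input p x]| = k ->
  (#|[set q | exact_cover board_line (mix X (perm_input p) (perm_input q))]|
     <= k`! * (m - k)`!)%N.
Proof.
rewrite perm_input_ones; set A := [set r | _] => Ak.
have := card_im_perm A (p @: A); rewrite Ak card_ord; apply: leq_trans.
apply/subset_leq_card/fintype.subsetP => q; rewrite !inE => /perm_input_mix[rows cols].
rewrite -!preim_permV; apply/eqP/setP => c; rewrite !inE rows !permKV.
by rewrite cols.
Qed.

Lemma nobdd_width_bin (P : nobdd n) k :
  (forall s, ~~ exact_cover board_line s <-> nobdd_accepts P s) ->
  (0 < k <= m)%N -> ('C(m, k) <= n * 2 ^ nobdd_width P)%N.
Proof.
move=> fP /andP[k0 km]; pose f s := ~~ exact_cover board_line s.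
(* All [m] ones of [p] are read at some level: zeroing the unread bits keeps the value of [f], hence
   leaves an exact cover. *)
have ones_all p : (0 < k <= #|[set x in read_before P (depth P) | perm_input p x]|)%N.
  rewrite k0 /=; pose s := mix (read_before P (depth P)) (perm_input p) [ffun=> false].
  have : exact_cover board_line s.
    rewrite -[exact_cover _ _]negbK -/(f s) -(@computed_read _ P f fP (perm_input p)).
      by rewrite /f perm_input_cover.
    by move=> x xP; rewrite [RHS]ffunE xP.
  move=> /perm_input_truncated sX.
  rewrite perm_input_ones (_ : finset _ = [set: 'I_m]%SET) ?cardsT ?card_ord //.
  by apply/setP => r; rewrite finset.in_setT inE sX.
have /fin_all_exists[J JP] p : exists j : 'I_n, (j < depth P)%N &&
    (#|[set x in read_before P j.+1 | perm_input p x]| == k).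
  have [j [jn jd jk]] := exists_level_ones (ones_all p).
  by exists (Ordinal jn); rewrite /= jd jk eqxx.
pose V j : {set node P} := [set v | level P v == j :> nat].
pose same_cut j W p := (J p == j) && (reach P (perm_input p) j.+1 == W).
(* All permutations of a fibre can be mixed with a fixed member [p0] at the same cut, and each
   mixture is rejected, that is, an exact cover. *)
have fibre j W : (\sum_(p : 'S_m | same_cut j W p) 1 <= k`! * (m - k)`!)%N.
  have [p0 /andP[/eqP Jp /eqP Wp]|none] := pickP (same_cut j W); last first.
    by rewrite big_pred0.
  have /andP[jd /eqP jk] := JP p0; rewrite Jp in jd jk.
  apply: leq_trans (card_perm_same_cut jk); rewrite sum1_card.
  apply/subset_leq_card/fintype.subsetP => p; rewrite !inE => /andP[_ /eqP Wp'].
  rewrite -[_ _ _]negbK -/(f _) (@computed_mix _ P f fP) ?Wp //.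
  by rewrite /f perm_input_cover.
have : (m`! <= n * 2 ^ nobdd_width P * (k`! * (m - k)`!))%N.
  rewrite -{1}(card_Sn m) -sum1_card (partition_big J predT) //=.
  rewrite -mulnA -[X in (X * _)%N]card_ord -sum_nat_const; apply: leq_sum => j _.
  rewrite (partition_big (fun p => reach P (perm_input p) j.+1)
    (mem (powerset (V j.+1)))) /=.
    apply: (@leq_trans (\sum_(W in powerset (V j.+1)) (k`! * (m - k)`!))).
      by apply: leq_sum => W _; exact: fibre.
    rewrite sum_nat_const card_powerset leq_mul2r leq_exp2l ?card_level ?orbT //.
  move=> p _; rewrite powersetE; apply/fintype.subsetP => v vr.
  by rewrite inE (@reach_level _ _ (perm_input p) j.+1).
by rewrite -(bin_fact km) leq_pmul2r // muln_gt0 !fact_gt0.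
Qed.

End Permutations.

(** * The separations *)

(** Taking base-2 logarithms, the last inequality reads 2 + 5 log2 m + 2d < 2m. Its half is the
    hypothesis, as log2 (m^2) = 2 log2 m. *)
Lemma nat_bound_of_log (R : realType) m d : (1 < d)%N ->
  d%:R < Num.sqrt ((m ^ 2)%:R : R) - 5 / 4 * log2 (m ^ 2)%:R - 1 ->
  (1 < m)%N /\ (4 * m * (m ^ 2 * 2 ^ d) ^ 2 < 4 ^ m)%N.
Proof.
move=> d1; rewrite natrX sqrtr_sqr normr_nat /log2 => dm.
have ln2 : 0 < ln 2 :> R by rewrite ln_gt0 ?ltr1n.
have d2 : 2 <= d%:R :> R by rewrite (ler_nat _ 2).
have m1 : (1 < m)%N.
  (* For m = 0, where [ln 0 = 0], and m = 1 the bound on [d] would be -1 and 0. *)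
  case: m dm => [|[|//]]; rewrite ?expr1n ?expr0n ?ln1 ?mul0r ?mulr0 ?subr0.
    by rewrite ln0 // mul0r mulr0; lra.
  by rewrite subrr; lra.
have m_gt0 := ltnW m1.
split=> //; have m0 : 0 < m%:R :> R by rewrite ltr0n.
rewrite -(ltr_nat R) -ltr_ln ?posrE ?ltr0n ?muln_gt0 ?expn_gt0 ?m_gt0 //.
rewrite !(natrM, natrX) (_ : 4%:R = 2 ^+ 2 :> R); last by rewrite -natrX.
rewrite !(lnM, lnXn) ?posrE ?mulr_gt0 ?exprn_gt0 ?ltr0n //.
rewrite lnXn // in dm.
have : d%:R * ln 2 < (m%:R - 5 / 4 * (ln m%:R *+ 2 / ln 2) - 1) * ln 2 :> R.
  by rewrite ltr_pM2r.
have : (ln m%:R *+ 2 / ln 2) * ln 2 = ln m%:R *+ 2 :> R by rewrite mulfVK ?gt_eqF.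
nra.
Qed.

Local Open Scope classical_set_scope.

Theorem theorem13 (R : realType) (n : nat) :
  (forall d1 d2 : nat, (1 < d1 <= n)%N -> (1 < d2 <= n)%N ->
     ~ (NOBDD_class n d2 `<=` NUOBDD_class R n d1)) /\
  ((exists m : nat, n = (m ^ 2)%N) ->
   forall d1 d2 : nat, (1 < d1)%N -> (1 < d2)%N ->
     d1%:R < Num.sqrt (n%:R : R) - 5 / 4 * log2 n%:R - 1 ->
     d2%:R < Num.sqrt (n%:R : R) - 5 / 4 * log2 n%:R - 1 ->
     ~ (NUOBDD_class R n d2 `<=` NOBDD_class n d1)).

Proof.
split=> [d1 d2 /andP[_ d1n] /andP[d2_gt1 _] sub|[m nE] d1 d2 d1_gt1 d2_gt1 d1_lt _ sub].
  by apply: (and_notin_NUOBDD _ d1n) (sub _ (and_in_NOBDD n d2_gt1)).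
subst n; have [m1 md] := nat_bound_of_log d1_gt1 d1_lt.
have E : #|{: 'I_m * 'I_m}| = (m ^ 2)%N by rewrite card_prod card_ord.
pose cell (rc : 'I_m * 'I_m) : 'I_(m ^ 2) := cast_ord E (enum_rank rc).
pose coord (x : 'I_(m ^ 2)) : 'I_m * 'I_m := enum_val (cast_ord (esym E) x).
have cellK : cancel cell coord by move=> rc; rewrite /coord cast_ordK enum_rankK.
have coordK : cancel coord cell by move=> x; rewrite /cell enum_valK cast_ordKV.
have [P [Pd1 fP]] := sub _ (not_exact_cover_in_NUOBDD (board_line coord) R d2_gt1).
have half_m : (0 < m./2 <= m)%N.
  by rewrite half_gt0 m1 -[X in (_ <= X)%N]odd_double_half -addnn addnA leq_addl.
have Cm : ('C(m, m./2) <= m ^ 2 * 2 ^ d1)%N.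
  apply: leq_trans (nobdd_width_bin cellK coordK fP half_m) _.
  by rewrite leq_mul2l leq_exp2l ?Pd1 ?orbT.
(* The contradiction is 4^m <= 4m C(m, m/2)^2 <= 4m (m^2 2^d1)^2 < 4^m. *)
have := middle_bin_sqr (ltnW m1); rewrite leqNgt => /negP; apply.
by apply: leq_ltn_trans md; rewrite leq_mul2l leq_exp2r // Cm orbT.
Qed.
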